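(* For every $n \geq 2$ there exist $N = 2n+2$ points in $\mathbb{R}^3$ and two radii $\rho_1, \rho_2$ such that the Čech complex of the points at radius $\rho_1$ has first Betti number $\beta_1 = (n+1)^2 - 1$, and the Čech complex at radius $\rho_2$ has second Betti number $\beta_2 = n^2$.
   Context: For a finite set $A \subseteq \mathbb{R}^d$ and $r \geq 0$, the Čech complex of $A$ and $r$ is the abstract simplicial complex of all nonempty subsets of $A$ whose closed balls of radius $r$ have nonempty common intersection. Betti numbers are reduced Betti numbers. *)

(* Defs.v *)
From HB Require Import structures.
(* classical_sets comes first so that set0, subsetU1, etc. denote those of
   finset. *)
From mathcomp Require Import boolp classical_sets reals.
From mathcomp Require Import all_boot all_order all_algebra finmap.

Set Implicit Arguments.
Unset Strict Implicit.
Unset Printing Implicit Defensive.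

Import GRing.Theory Num.Theory.

Local Open Scope ring_scope.

(* Abstract simplicial complexes on a finite vertex type T are sets of
   nonempty faces K : {set {set T}}, closed under nonempty subsets. *)
Definition simplicial_complex (T : finType) (K : {set {set T}}) : Prop :=
  set0 \notin K /\
  forall s t : {set T}, s \in K -> t \subset s -> t != set0 -> t \in K.

(* Simplicial chains with coefficients in F are functions {set T} -> F; the
   chain groups of all dimensions and of all complexes on T live in this single
   vector space. The vertices are ordered by enum_rank, and each face carries
   the orientation given by this order. *)
Definition chain (F : fieldType) (T : finType) := {ffun {set T} -> F^o}.

Section SimplicialHomology.
Variables (F : fieldType) (T : finType).
Implicit Types (K : {set {set T}}) (s t : {set T}) (v w : T) (p : nat).

Definition elementary_chain s : chain F T := [ffun t : {set T} => (t == s)%:R].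

Definition chains K p : {vspace chain F T} :=
  <<[seq elementary_chain s | s <- enum K & #|s| == p.+1]>>%VS.

Definition vlt v w : bool := (enum_rank v < enum_rank w)%N.

Definition incidence v t : F := (-1) ^+ #|[set u in t | vlt u v]|.

(* The coefficient of the face t in the boundary of c comes from the faces
   v |: t, in which v has position #|[set u in t | vlt u v]|: this is
   [v_0, ..., v_k] |-> \sum_i (-1)^i [v_0, .., v_i omitted, .., v_k].
   A vertex is sent to the empty face, i.e., the complex is augmented, so that
   the homology below is reduced. *)
Definition boundary_fun (c : chain F T) : chain F T :=
  [ffun t : {set T} => \sum_(v | v \notin t) incidence v t * c (v |: t)].

Fact boundary_fun_is_linear : linear boundary_fun.
Proof.
move=> a c d; apply/ffunP => t; rewrite !ffunE scaler_sumr -big_split /=.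
by apply: eq_bigr => v _; rewrite !ffunE mulrDr mulrCA.
Qed.

HB.instance Definition _ := GRing.isLinear.Build F (chain F T) (chain F T) _
  boundary_fun boundary_fun_is_linear.

Definition boundary : 'End(chain F T) := linfun boundary_fun.

Definition cycles K p : {vspace chain F T} := (chains K p :&: lker boundary)%VS.

Definition boundaries K p : {vspace chain F T} :=
  (boundary @: chains K p.+1)%VS.

(* Reduced Betti number: the dimension of the quotient of cycles by boundaries.
   The difference is not truncated, by boundaries_sub_cycles below. *)
Definition betti K p : nat := (\dim (cycles K p) - \dim (boundaries K p))%N.

Lemma boundaryE c t :
  boundary c t = \sum_(v | v \notin t) incidence v t * c (v |: t).
Proof. by rewrite lfunE ffunE. Qed.

Lemma chainsP K p (c : chain F T) :
  reflect (forall s, c s != 0 -> (s \in K) && (#|s| == p.+1))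
          (c \in chains K p).
Proof.
apply: (iffP idP) => [cK s | sup_c].
  rewrite (coord_span (X := in_tuple _) cK).
  apply: contraR => notKs; rewrite sum_ffunE big1 // => i _; rewrite ffunE.
  have /mapP[t + ->] := mem_nth 0 (ltn_ord i).
  rewrite mem_filter mem_enum andbC => Kt.
  by rewrite ffunE (_ : s == t = false) ?scaler0 //;
    apply: contraNF notKs => /eqP->.
have -> : c = \sum_s (c s : F) *: elementary_chain s.
  apply/ffunP => t; rewrite sum_ffunE (bigD1 t) //= big1 => [|s /negPf nst].
    by rewrite !ffunE eqxx addr0 /GRing.scale /= mulr1.
  by rewrite !ffunE eq_sym nst scaler0.
apply: rpred_sum => s _; have [->|/sup_c Ks] := eqVneq (c s) 0.
  by rewrite scale0r rpred0.
by apply/rpredZ/memv_span/map_f; rewrite mem_filter mem_enum andbC.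
Qed.

Lemma incidence_anticomm t v w : v \notin t -> w \notin t -> v != w ->
  incidence v t * incidence w (v |: t) =
  - (incidence w t * incidence v (w |: t)).
Proof.
have incU x y : x \notin t ->
    incidence y (x |: t) = (-1) ^+ vlt x y * incidence y t.
  move=> tx; rewrite /incidence -exprD; congr (_ ^+ _).
  have [xy|xy] := boolP (vlt x y).
    rewrite (_ : [set u in x |: t | vlt u y] = x |: [set u in t | vlt u y]).
      by rewrite cardsU1 inE (negPf tx).
    by apply/setP => u; rewrite !inE; case: eqVneq => // ->; rewrite xy.
  apply/eq_card => u; rewrite !inE.
  by case: eqVneq => // ->; rewrite (negPf xy) !andbF.
move=> tv tw nvw; rewrite (incU v w) // (incU w v) //.
have -> : vlt v w = ~~ vlt w v.
  rewrite /vlt -leqNgt ltn_neqAle.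
  by rewrite (inj_eq val_inj) (inj_eq enum_rank_inj) nvw.
by case: (vlt w v); rewrite ?expr0 ?expr1 ?mulN1r ?mul1r ?mulrN ?opprK mulrC.
Qed.

Lemma boundaryK c : boundary (boundary c) = 0.
Proof.
apply/ffunP => t; rewrite boundaryE ffunE.
pose G v w : F := incidence v t * incidence w (v |: t) * c (w |: (v |: t)).
have -> : \sum_(v | v \notin t) incidence v t * boundary c (v |: t) =
    \sum_(v | v \notin t) \sum_(w | (w \notin t) && (w != v)) G v w.
  apply: eq_bigr => v tv; rewrite boundaryE mulr_sumr; apply: eq_big => [w|w _].
    by rewrite !inE negb_or andbC.
  by rewrite mulrA.
rewrite pair_big_dep /=.
pose P (q : T * T) := [&& q.1 \notin t, q.2 \notin t & q.2 != q.1].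
rewrite (bigID (fun q : T * T => vlt q.1 q.2)) /=.
have swapK : involutive (fun q : T * T => (q.2, q.1)) by case.
rewrite [X in _ + X](reindex_inj (inv_inj swapK)) /=.
rewrite [X in _ + X](eq_bigl (fun q => P q && vlt q.1 q.2)) => [|[v w]] /=.
  rewrite -big_split big1 //= => -[v w] /= /andP[/and3P[tv tw nwv] _].
  by rewrite /G setUCA (incidence_anticomm tv tw) 1?eq_sym // mulNr addNr.
rewrite /P /= andbCA (eq_sym v w); case: (eqVneq w v) => [|nwv] /=.
  by rewrite !andbF.
congr (_ && _); rewrite /vlt -leqNgt leq_eqVlt.
by rewrite (inj_eq val_inj) (inj_eq enum_rank_inj) eq_sym (negPf nwv).
Qed.

Lemma boundaries_sub_cycles K p :
  simplicial_complex K -> (boundaries K p <= cycles K p)%VS.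
Proof.
move=> [_ Kdown]; apply/subvP => _ /memv_imgP[c /chainsP sup_c ->].
rewrite memv_cap memv_ker boundaryK eqxx andbT; apply/chainsP => t.
apply: contraR => notKt; rewrite boundaryE big1 // => v tv.
have [->|/sup_c/andP[Kvt]] := eqVneq (c (v |: t)) 0; first by rewrite mulr0.
rewrite cardsU1 tv eqSS => card_t; rewrite card_t andbT in notKt.
case/negP: notKt; apply: Kdown Kvt (subsetU1 _ _) _.
by rewrite -card_gt0 (eqP card_t).
Qed.

End SimplicialHomology.

Section CechComplex.
Variables (R : realType) (d : nat).
Implicit Types (x y a : 'rV[R]_d) (A : {fset 'rV[R]_d}) (r : R).

(* The norm that MathComp-Analysis puts on 'rV[R]_d is the sup norm. *)
Definition edist x y : R := Num.sqrt (\sum_i (x 0 i - y 0 i) ^+ 2).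

Definition closed_eball a r : set 'rV[R]_d := [set x | edist x a <= r]%classic.

(* The vertex type is the finite type of the elements of A. *)
Definition Cech A r : {set {set A}} :=
  [set s : {set A} | (s != set0) &&
    `[< (\bigcap_(a in [set` s]) closed_eball (val a) r !=set0)%classic >]].

Lemma Cech_simplicial_complex A r : simplicial_complex (Cech A r).
Proof.
split=> [|s t]; rewrite !inE ?eqxx // => /andP[_ /asboolP[x sx]] /subsetP ts ->.
by apply/asboolP; exists x => a /ts; exact: sx.
Qed.

End CechComplex.

(* Main.v *)
(* The points lie on two short arcs of parabolas, (1 - t^2/2, t, 0) and
   (u^2/2, 0, u), with parameters 0, h, ..., n h and h = 1 / (16 n^2). Points of
   different arcs have squared distance 1 + (t^2 + u^2)^2 / 4, so all these
   distances are 1 up to an error much smaller than h^2. Squared radii at which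
   faces with vertices on both arcs appear, up to the same error:
     edges: 1/4;  triangles with a side of m steps: 1/4 + m^2 h^2 / 16;
     tetrahedra with two vertices on each arc: at least 1/4 + h^2 / 8.
   Subsets of a single arc are present from 1/4 on. At squared radius
   1/4 + h^2/32 the complex consists of two full simplices and all cross edges;
   at 1/4 + 3h^2/32 it has in addition the triangles on two consecutive points of
   one arc and any point of the other.

   Let d_p be the rank of the boundary on p-chains. An acyclic matching bounds
   d_p from below, and d_p + d_(p+1) is at most the number of p-faces since the
   boundary squares to zero. Wherever the lower bounds add up to the number of
   faces, all these inequalities are equalities, and the Betti numbers follow
   without exhibiting any cycle. *)
Require Import Defs.
From mathcomp Require Import boolp classical_sets reals.
From mathcomp Require Import all_boot all_order all_algebra finmap.
From mathcomp Require Import zify ring lra.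

Set Implicit Arguments.
Unset Strict Implicit.
Unset Printing Implicit Defensive.

Import Order.TTheory GRing.Theory Num.Theory.

Local Open Scope ring_scope.

(** * Ranks of boundary maps *)

Section BettiNumbers.
Variables (F : fieldType) (T : finType).
Implicit Types (K S : {set {set T}}) (s t : {set T}) (p : nat).

Definition faces K p := [set s in K | #|s| == p.+1].

Lemma dim_chains K p : \dim (chains F K p) = #|faces K p|.
Proof.
pose Z : seq {set T} := [seq s : {set T} <- enum K | #|s| == p.+1].
pose X := [seq elementary_chain F s | s <- Z].
have sz : size X = #|faces K p|.
  rewrite size_map -(card_uniqP (filter_uniq _ (enum_uniq _))).
  by apply: eq_card => s; rewrite !inE mem_filter mem_enum andbC.
rewrite -sz; apply: (@size_basis _ _ _ _ (in_tuple X)).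
rewrite basisEfree subvv dim_span /= andbT.
apply/(@freeP _ _ _ (in_tuple X)) => /= k k0 i.
have szE : size X = size Z by rewrite size_map.
move/ffunP/(_ (nth (set0 : {set T}) Z i)): k0.
rewrite sum_ffunE (bigD1 i) //= big1 => [|j ji].
  rewrite !ffunE (nth_map (set0 : {set T})) -?szE // ffunE eqxx addr0 => <-.
  by rewrite /GRing.scale /= mulr1.
rewrite ffunE (nth_map (set0 : {set T})) -?szE // ffunE.
rewrite nth_uniq -?szE ?(filter_uniq _ (enum_uniq _)) //.
by rewrite eq_sym -val_eqE /= in ji; rewrite (negPf ji) scaler0.
Qed.

Lemma eq_chains K L p : faces K p = faces L p -> chains F K p = chains F L p.
Proof.
move=> /setP eKL; apply/vspaceP => c; apply/chainsP/chainsP => h s /h;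
by have := eKL s; rewrite !inE => ->.
Qed.

Lemma dim_cycles K p :
  (\dim (cycles F K p) + \dim (boundary F T @: chains F K p) = #|faces K p|)%N.
Proof. by rewrite limg_ker_dim dim_chains. Qed.

(** Rank-nullity combined with boundaries being cycles; this upper bound is played against the
    matchings below. *)
Lemma leq_dim_boundaries K p : simplicial_complex K ->
  (\dim (boundary F T @: chains F K p) + \dim (boundaries F K p)
     <= #|faces K p|)%N.
Proof.
by move=> sK; rewrite -dim_cycles addnC leq_add2r dimvS // boundaries_sub_cycles.
Qed.

(* An acyclic matching s |-> s :\ v from S into the facets makes the boundary
   triangular on the span of S, so it is injective there. *)
Lemma geq_dim_boundaries K S p (r : {set T} -> nat) :
  S \subset faces K p ->
  (forall s, s \in S -> exists2 v, v \in s &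
     forall u, u \notin s :\ v -> u != v -> u |: (s :\ v) \in S ->
       (r s < r (u |: (s :\ v)))%N) ->
  (#|S| <= \dim (boundary F T @: chains F K p))%N.
Proof.
move=> /subsetP sSK match_S.
have fS : faces S p = S.
  by apply/setP => s; rewrite inE andb_idr // => /sSK; rewrite inE => /andP[].
have inj : (chains F S p :&: lker (boundary F T))%VS = 0%VS.
  apply/eqP; rewrite -subv0; apply/subvP => c; rewrite memv_cap memv_ker memv0.
  case/andP => /chainsP cS /eqP dc0; apply: contraT => c0.
  have [s0 cs0] : exists s, c s != 0.
    apply/existsP; apply: contraR c0; rewrite negb_exists => /forallP c0.
    by apply/eqP/ffunP => s; rewrite ffunE; apply/eqP; have := c0 s; rewrite negbK.
  (* In a nonzero cycle on [S], take a supporting face [s] of maximal [r]. Any other face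
     contributing at [s :\ v] would have larger [r], so the coefficient there is [c s] up to sign,
     which is nonzero. *)
  case: (@arg_maxnP _ s0 (fun s => c s != 0) r cs0) => s cs max_s.
  have /andP[sS _] := cS _ cs; have [v vs acyc] := match_S _ sS.
  have /ffunP/(_ (s :\ v)) := dc0; rewrite boundaryE ffunE.
  rewrite (bigD1 v) /=; last by rewrite !inE eqxx.
  rewrite setD1K // big1 ?addr0 => [/eqP|u /andP[us uv]].
    by rewrite mulf_eq0 signr_eq0 (negPf cs).
  apply/eqP; rewrite mulf_eq0; apply/orP; right; apply: contraT => cu.
  have := max_s _ cu; rewrite /= leqNgt => /negP[]; apply: acyc => //.
  by case/andP: (cS _ cu).
rewrite -{1}fS -dim_chains -(limg_dim_eq inj).
apply/dimvS/limgS/subvP => c /chainsP cS; apply/chainsP => s /cS /andP[/sSK].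
by rewrite inE.
Qed.

(** Match each face through [v0] with its facet opposite [v0]. Filling that facet by another vertex
    misses [v0], so acyclicity is vacuous and a constant weight serves. *)
Lemma geq_dim_boundaries_star K p (v0 : T) :
  (#|[set s in faces K p | v0 \in s]| <= \dim (boundary F T @: chains F K p))%N.
Proof.
apply: (geq_dim_boundaries (r := fun=> 0%N)) => [|s]; rewrite ?inE.
  by apply/subsetP => s; rewrite inE => /andP[].
case/andP => _ v0s; exists v0 => // u _ /negPf uv0.
by rewrite !inE eqxx [v0 == u]eq_sym uv0 andbF.
Qed.

(** Stars at one vertex give [d_0 >= 1] and [d_1 >= #|T| - 1], while [d_0 + d_1 <= #|T|]. *)
Lemma dim_boundary_complete_graph K : simplicial_complex K ->
  (forall s, #|s| = 1%N -> s \in K) -> (forall s, #|s| = 2%N -> s \in K) ->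
  (0 < #|T|)%N ->
  \dim (boundary F T @: chains F K 1) = #|T|.-1.
Proof.
move=> sK K1 K2 /card_gt0P[v0 _].
have c0 : #|faces K 0| = #|T|.
  rewrite -(card_imset predT (@set1_inj T)); apply: eq_card => s.
  rewrite !inE; apply/andP/imsetP => [[_ /cards1P[x ->]]|[x _ ->]].
    by exists x.
  by rewrite K1 cards1.
have := geq_dim_boundaries_star K 0 v0; have := leq_dim_boundaries 0 sK.
rewrite c0 /boundaries; set d0 := \dim _; set d1 := \dim _ => d01 d0_ge.
have d0_gt0 : (0 < d0)%N.
  apply: leq_trans d0_ge; apply/card_gt0P; exists [set v0].
  by rewrite !inE K1 ?cards1 ?eqxx.
have : (#|T|.-1 <= d1)%N.
  apply: leq_trans (geq_dim_boundaries_star K 1 v0).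
  rewrite -(cardC1 v0) -(@card_in_imset _ _ (fun x => [set v0; x])).
    apply/subset_leq_card/subsetP => _ /imsetP[x + ->]; rewrite !inE => xv0.
    have c2 : #|[set v0; x]| = 2%N by rewrite cards2 eq_sym xv0.
    by rewrite K2 c2 // !eqxx.
  move=> x y; rewrite -!topredE /= => xv0 _ /setP/(_ x); rewrite !inE eqxx orbT.
  by rewrite (negPf xv0) /= => /esym/eqP.
by lia.
Qed.

End BettiNumbers.

(** * Two simplices joined by cross edges and cross triangles *)

Section TwoSides.
Local Open Scope nat_scope.
Variables (T : finType) (n : nat).
Variables (e : bool * 'I_n.+1 -> T) (g : T -> bool * 'I_n.+1).
Hypotheses (eK : cancel e g) (gK : cancel g e).
Implicit Types (K : {set {set T}}) (s t : {set T}) (p : nat).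

Definition side (x : T) : bool := (g x).1.
Definition idx (x : T) : nat := (g x).2.

Definition one_sided s : bool :=
  [forall x in s, forall y in s, side x == side y].

(** The disjoint union of two full n-simplices. *)
Definition one_sided_faces : {set {set T}} :=
  [set s | (s != set0) && one_sided s].
Local Notation L := one_sided_faces.

(** Each of the two simplices is a cone whose apex is its vertex of index 0. *)
Definition apical_faces p : {set {set T}} :=
  [set s in faces L p | [exists x in s, idx x == 0]].

Definition cross_edge (q : 'I_n.+1 * 'I_n.+1) : {set T} :=
  [set e (false, q.1); e (true, q.2)].

(** [widen_ord] and [lift ord0] send [i < n] to the consecutive indices [i] and [i + 1]. *)
Definition cross_triangle (q : bool * ('I_n * 'I_n.+1)) : {set T} :=
  [set e (q.1, widen_ord (leqnSn n) q.2.1); e (q.1, lift ord0 q.2.1);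
       e (~~ q.1, q.2.2)].

Definition cross_triangles : {set {set T}} := [set cross_triangle q | q in setT].

Lemma side_idx_inj x y : side x = side y -> idx x = idx y -> x = y.
Proof.
rewrite /side /idx => h1 /val_inj h2; apply: (can_inj gK).
by rewrite (surjective_pairing (g x)) h1 h2 -surjective_pairing.
Qed.

Lemma side_e b i : side (e (b, i)) = b. Proof. by rewrite /side eK. Qed.
Lemma idx_e b i : idx (e (b, i)) = i. Proof. by rewrite /idx eK. Qed.

Lemma card_vertices : #|T| = n.+1.*2.
Proof.
rewrite -(bij_eq_card (Bijective eK gK)).
by rewrite card_prod card_bool card_ord mul2n.
Qed.

Lemma eq_e b i c j : (e (b, i) == e (c, j)) = (b == c) && (i == j :> nat).
Proof. by rewrite (can_eq eK). Qed.

Lemma one_sidedP s :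
  reflect {in s &, forall x y, side x = side y} (one_sided s).
Proof.
apply: (iffP idP) => [/forall_inP h x y /h /forall_inP hx /hx /eqP //|h].
by apply/forall_inP => x xs; apply/forall_inP => y ys; apply/eqP/h.
Qed.

Lemma not_one_sidedP s :
  reflect (exists i j, e (false, i) \in s /\ e (true, j) \in s)
          (~~ one_sided s).
Proof.
apply: (iffP idP) => [|[i [j [si sj]]]]; last first.
  by apply/negP => /one_sidedP/(_ _ _ si sj); rewrite !side_e.
rewrite negb_forall => /existsP[x]; rewrite negb_imply negb_forall.
case/andP=> xs /existsP[y]; rewrite negb_imply => /andP[ys].
rewrite -(gK x) in xs *; rewrite -(gK y) in ys *; move: xs ys.
case: (g x) (g y) => [[] i] [[] j]; rewrite !side_e // => xs ys _.
  by exists j, i.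
by exists i, j.
Qed.

(** * Boundary ranks of two disjoint simplices *)

Lemma simplicial_complex_one_sided : simplicial_complex L.
Proof.
split=> [|s t]; rewrite !inE ?eqxx // => /andP[_ /one_sidedP sP] /subsetP ts ->.
by apply/one_sidedP => x y /ts xs /ts; exact: sP.
Qed.

Lemma one_sided1 x : one_sided [set x].
Proof. by apply/one_sidedP => y z /set1P-> /set1P->. Qed.

(* Each face without apex is the base of an apical face. *)
Lemma leq_card_one_sided_faces p :
  #|faces L p| <= #|apical_faces p| + #|apical_faces p.+1|.
Proof.
rewrite -(cardsID [set s : {set T} | [exists x in s, idx x == 0]] (faces L p)).
apply: leq_add.
  by apply/subset_leq_card/subsetP => s; rewrite !inE.
pose Ap := [set x | idx x == 0].
apply: leq_trans (leq_imset_card (fun t : {set T} => t :\: Ap) _).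
apply/subset_leq_card/subsetP => s; rewrite !inE negb_exists.
case/andP=> /forallP ns /andP[/andP[/set0Pn[x xs] /one_sidedP oss] /eqP cs].
have s0 y : y \in s -> idx y != 0 by move=> ys; have := ns y; rewrite ys.
pose a := e (side x, ord0).
have na : a \notin s by apply/negP => /s0; rewrite idx_e.
apply/imsetP; exists (a |: s); last first.
  apply/setP => y; rewrite !inE; have [ys|ys] := boolP (y \in s).
    by rewrite orbT s0.
  by rewrite orbF; case: (y =P a) => [->|]; rewrite ?idx_e ?andbF.
rewrite !inE cardsU1 na cs eqxx andbT; apply/andP; split; last first.
  by apply/exists_inP; exists a; rewrite ?inE ?eqxx ?idx_e.
apply/andP; split; first by apply/set0Pn; exists a; rewrite !inE eqxx.
have side_a y : y \in a |: s -> side y = side x.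
  by rewrite !inE => /predU1P[->|ys]; [rewrite side_e | apply: oss].
by apply/one_sidedP => y z /side_a-> /side_a->.
Qed.

(** Remove the apex. Since [0 < p], a remaining vertex fixes the side, so only the same apex can
    restore an apical face. *)
Lemma apical_facet p s : 0 < p -> s \in apical_faces p ->
  exists2 v, v \in s & forall u, u \notin s :\ v -> u != v ->
    u |: (s :\ v) \notin apical_faces p.
Proof.
move=> p0; rewrite !inE => /andP[/andP[/andP[_ /one_sidedP oss] /eqP cs]].
case/exists_inP => v vs /eqP v0; exists v => // u us uv; rewrite !inE.
apply/negP => /andP[/andP[/andP[_ /one_sidedP osu] _] /exists_inP[y]].
rewrite !inE => /predU1P[->|/andP[yv ys]] /eqP y0; last first.
  by case/eqP: yv; apply: side_idx_inj; rewrite ?v0 //; apply: oss.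
have : 0 < #|s :\ v| by move: cs; rewrite (cardsD1 v) vs; lia.
case/card_gt0P => z zsv; have /setD1P[_ zs] := zsv.
case/eqP: uv; apply: side_idx_inj; rewrite ?v0 // (oss v z) //.
by apply: osu; rewrite !inE ?eqxx // -in_setD1 zsv orbT.
Qed.

Lemma geq_dim_boundaries_one_sided (F : fieldType) p : 0 < p ->
  #|apical_faces p| <= \dim (boundary F T @: chains F L p).
Proof.
move=> p0; apply: (@geq_dim_boundaries _ _ _ _ _ (fun=> 0)) => [|s sS].
  by apply/subsetP => s; rewrite inE => /andP[].
have [v vs nS] := apical_facet p0 sS; exists v => // u us uv.
by rewrite (negPf (nS _ us uv)).
Qed.

(* A count of faces, read off from ranks over an arbitrarily chosen field. *)
Lemma card_one_sided_faces p : 0 < p ->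
  #|faces L p| = #|apical_faces p| + #|apical_faces p.+1|.
Proof.
move=> p0; apply/eqP; rewrite eqn_leq leq_card_one_sided_faces.
apply: leq_trans (leq_dim_boundaries 'F_2 p simplicial_complex_one_sided).
by apply: leq_add; apply: geq_dim_boundaries_one_sided.
Qed.

(** With [a_p] apical p-faces, [d_p >= a_p], [d_(p+1) >= a_(p+1)] and
    [d_p + d_(p+1) <= a_p + a_(p+1)] force equalities. *)
Lemma dim_boundaries_one_sided (F : fieldType) p : 0 < p ->
  \dim (boundaries F L p) = #|apical_faces p.+1|.
Proof.
move=> p0.
have := leq_dim_boundaries F p simplicial_complex_one_sided.
rewrite card_one_sided_faces //.
have := geq_dim_boundaries_one_sided F p0.
have : #|apical_faces p.+1| <= \dim (boundaries F L p).
  exact: geq_dim_boundaries_one_sided.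
by lia.
Qed.

Lemma card_apical_edges : #|apical_faces 1| = n.*2.
Proof.
pose f (q : bool * 'I_n) := [set e (q.1, ord0); e (q.1, lift ord0 q.2)].
have -> : apical_faces 1 = [set f q | q in setT].
  apply/setP => s; rewrite !inE; apply/idP/imsetP; last first.
    case=> -[b i] _ ->; rewrite /f /= cards2 eq_e /= andbF eqxx andbT.
    apply/andP; split; last by apply/exists_inP; exists (e (b, ord0)); rewrite ?inE ?eqxx ?idx_e.
    apply/andP; split; first by apply/set0Pn; exists (e (b, ord0)); rewrite !inE eqxx.
    by apply/one_sidedP => x y; rewrite !inE => /pred2P[]-> /pred2P[]->; rewrite !side_e.
  case/andP => /andP[/andP[_ /one_sidedP oss] /cards2P[x [y [xy sxy]]]].
  wlog x0 : x y xy sxy / idx x == 0.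
    move=> wl /exists_inP[z]; rewrite {1}sxy !inE => /pred2P[]-> z0.
      by apply: (wl x y) => //; apply/exists_inP; exists x; rewrite // sxy !inE eqxx.
    apply: (wl y x) => //; rewrite 1?eq_sym 1?setUC //.
    by apply/exists_inP; exists y; rewrite // sxy !inE eqxx orbT.
  move=> _; have yx : side y = side x by apply: oss; rewrite sxy !inE eqxx ?orbT.
  have y0 : idx y != 0.
    by apply: contra xy => y0; apply/eqP/side_idx_inj; rewrite // (eqP x0) (eqP y0).
  have y1 : (idx y).-1 < n by move: y0 (ltn_ord (g y).2); rewrite /idx; lia.
  exists (side x, Ordinal y1) => //; rewrite sxy /f /=; congr [set _; _].
    by apply: side_idx_inj; rewrite ?side_e ?idx_e ?(eqP x0).
  by apply: side_idx_inj; rewrite ?side_e ?idx_e ?yx //= /bump; lia.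
rewrite card_imset ?cardsT ?card_prod ?card_bool ?card_ord ?mul2n //.
move=> [b i] [c j] /setP h; have := h (e (b, lift ord0 i)); rewrite !inE !eq_e.
rewrite !eqxx /= ?andbF /= => /esym/andP[/eqP-> /eqP].
by rewrite /bump => ij; congr (_, _); apply: val_inj => /=; lia.
Qed.

(** * Faces with vertices on both sides *)

Lemma cross_triangleE b i j c k :
  (e (c, k) \in cross_triangle (b, (i, j))) =
  if c == b then (k == i :> nat) || (k == i.+1 :> nat) else k == j :> nat.
Proof. by rewrite !inE !eq_e /= /bump; case: b c => [] []; rewrite /= ?orbF. Qed.

Lemma card_cross_triangle q : #|cross_triangle q| = 3.
Proof.
case: q => b [i j]; rewrite /cross_triangle setUC cardsU1 cards2 !inE !eq_e /=.
by rewrite /bump leq0n; case: b => /=; lia.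
Qed.

(** Testing the three vertices of one triangle for membership in the other leaves arithmetic on
    indices. *)
Lemma cross_triangle_inj : injective cross_triangle.
Proof.
move=> [b [i j]] [c [k l]] /setP h.
have E d m := h (e (d, m)).
have := E b (widen_ord (leqnSn n) i); have := E b (lift ord0 i).
have := E (~~ b) j; rewrite !cross_triangleE /= /bump leq0n => h1 h2 h3.
have [-> [-> ->]] // : b = c /\ i = k /\ j = l.
have : b = c /\ i = k :> nat /\ j = l :> nat.
  by move: h1 h2 h3; case: b c {h E} => [] [] /=; lia.
by case=> -> [/val_inj-> /val_inj->].
Qed.

Lemma cross_triangle_two_sided q : ~~ one_sided (cross_triangle q).
Proof.
case: q => b [i j]; apply/negP => /one_sidedP/(_ (e (b, lift ord0 i)) (e (~~ b, j))).
rewrite !inE !eqxx !orbT !side_e => /(_ isT isT); by case: b.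
Qed.

(** Choose one vertex on each side; the third shares a side [b] with one of them, and that pair is
    sorted by index. *)
Lemma two_sided_card3 s : #|s| = 3 -> ~~ one_sided s ->
  exists b (i j k : 'I_n.+1),
    (i < j) /\ s = [set e (b, i); e (b, j); e (~~ b, k)].
Proof.
move=> cs /not_one_sidedP[i [j [si sj]]].
have nij : e (false, i) != e (true, j) by rewrite eq_e.
have sj' : e (true, j) \in s :\ e (false, i) by rewrite !inE eq_sym nij.
move: cs; rewrite (cardsD1 (e (false, i)) s) si (cardsD1 (e (true, j))) sj' => -[/eqP/cards1P[z Ez]].
have zE : z \in [set z] by rewrite inE.
have Es : s = [set e (false, i); e (true, j); z].
  by rewrite -(setD1K si) -(setD1K sj') Ez setUA.
move: zE; rewrite -Ez !inE => /and3P[+ + _].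
rewrite -(gK z) in Es *; move: Es; case: (g z) => -[] k Es; rewrite !eq_e /= => zj zi.
  have [jk|kj|/val_inj jk] := ltngtP j k; last by rewrite jk eqxx in zj.
    by exists true, j, k, i; split=> //; rewrite Es -setUA setUC.
  by exists true, k, j, i; split=> //; rewrite Es -setUA setUC (setUC [set e (true, k)]).
have [ik|ki|/val_inj ik] := ltngtP i k; last by rewrite ik eqxx in zi.
  by exists false, i, k, j; split=> //; rewrite Es setUAC.
by exists false, k, i, j; split=> //; rewrite Es setUAC (setUC [set e (false, k)]).
Qed.

(** The vertices split 3+1 or 2+2, and among three distinct indices two differ by at least 2. *)
Lemma two_sided_card4 s : #|s| = 4 -> ~~ one_sided s ->
  (exists b (i j k : 'I_n.+1), (i + 2 <= j) /\
     [/\ e (b, i) \in s, e (b, j) \in s & e (~~ b, k) \in s]) \/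
  (exists i j k l : 'I_n.+1, [/\ (i < j), (k < l) &
     [/\ e (false, i) \in s, e (false, j) \in s,
         e (true, k) \in s & e (true, l) \in s]]).
Proof.
move=> cs os; have [i0 [j0 [si0 sj0]]] := not_one_sidedP _ os.
have cD b : #|[set k | e (b, k) \in s]| = #|[set x in s | side x == b]|.
  rewrite -(card_imset _ (f := fun k => e (b, k))); last first.
    by move=> k l /(can_inj eK) [].
  apply: eq_card => x; rewrite inE; apply/imsetP/andP => [[k + ->]|[xs /eqP xb]].
    by rewrite inE side_e.
  by exists (g x).2; rewrite ?inE -xb -surjective_pairing gK.
have cDD : #|[set k | e (false, k) \in s]| + #|[set k | e (true, k) \in s]| = 4.
  rewrite !cD -cs addnC -(cardsID [set x | side x] s); congr (_ + _).
    by apply: eq_card => x; rewrite !inE eqb_id.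
  by apply: eq_card => x; rewrite !inE eqbF_neg andbC.
have far b (k : 'I_n.+1) : e (~~ b, k) \in s -> 2 < #|[set k | e (b, k) \in s]| ->
  exists b (i j k : 'I_n.+1), (i + 2 <= j) /\
     [/\ e (b, i) \in s, e (b, j) \in s & e (~~ b, k) \in s].
  move=> sk /card_gt2P[x [y [z [[]]]]]; rewrite !inE -!val_eqE /= => sx sy sz [xy yz zx].
  exists b.
  have [xy2|] := leqP (x + 2) y; first by exists x, y, k.
  have [xy2|] := leqP (x + 2) z; first by exists x, z, k.
  have [xy2|] := leqP (y + 2) x; first by exists y, x, k.
  have [xy2|] := leqP (y + 2) z; first by exists y, z, k.
  have [xy2|] := leqP (z + 2) x; first by exists z, x, k.
  have [xy2|] := leqP (z + 2) y; first by exists z, y, k.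
  by lia.
have [/far|c1] := ltnP 2 #|[set k | e (false, k) \in s]|; first by move/(_ j0 sj0); left.
have [/far|c2] := ltnP 2 #|[set k | e (true, k) \in s]|; first by move/(_ i0 si0); left.
right; have pair b : 1 < #|[set k | e (b, k) \in s]| ->
    exists i j : 'I_n.+1, [/\ i < j, e (b, i) \in s & e (b, j) \in s].
  case/card_gt1P => x [y []]; rewrite !inE => sx sy.
  rewrite -val_eqE neq_ltn => /orP[]; by [exists x, y | exists y, x].
have [|i [j [ij si sj]]] := pair false; first by lia.
have [|k [l [kl sk sl]]] := pair true; first by lia.
by exists i, j, k, l.
Qed.

(** * Betti numbers from rank counts *)

Lemma card_cross_edge_faces K :
  (forall s, #|s| = 2 -> s \in K) ->
  #|faces K 1| = #|faces L 1| + n.+1 ^ 2.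
Proof.
move=> K2; rewrite -(cardsID [set s : {set T} | one_sided s] (faces K 1)).
congr (_ + _).
  apply: eq_card => s; rewrite !inE; have [/eqP cs|] := boolP (#|s| == 2).
    by rewrite K2 // -card_gt0 cs !andbT.
  by rewrite !andbF.
have -> : faces K 1 :\: [set s : {set T} | one_sided s] = [set cross_edge q | q in setT].
  apply/setP => s; rewrite !inE; apply/idP/imsetP; last first.
    case=> -[i j] _ ->; have c2 : #|cross_edge (i, j)| = 2 by rewrite cards2 eq_e.
    rewrite K2 // c2 andbT; apply/not_one_sidedP; exists i, j.
    by rewrite !inE !eqxx orbT.
  case/andP=> /not_one_sidedP[i [j [si sj]]] /andP[_ /eqP cs]; exists (i, j) => //.
  apply/eqP; rewrite eq_sym eqEcard cs /cross_edge cards2 eq_e /= andbT.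
  by apply/subsetP => x; rewrite !inE => /pred2P[]->.
rewrite card_imset ?cardsT ?card_prod ?card_ord //.
move=> [i j] [k l] /setP h; have := h (e (false, i)); have := h (e (true, j)).
rewrite !inE !eq_e !eqxx /= ?orbF ?orbT => /esym/eqP jl /esym/eqP ik.
by congr (_, _); apply: val_inj.
Qed.

(** With [a_2] apical triangles there are [2n + a_2 + (n+1)^2] edges; [d_1 = 2n + 1] and [d_2 = a_2]
    leave [(n+1)^2 - 1]. *)
Theorem betti1_one_sided (F : fieldType) K : simplicial_complex K ->
  (forall s, #|s| = 1 -> s \in K) -> (forall s, #|s| = 2 -> s \in K) ->
  (forall s, #|s| = 3 -> (s \in K) = one_sided s) ->
  betti F K 1 = (n + 1) ^ 2 - 1.
Proof.
move=> sK K1 K2 K3.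
have := dim_cycles F K 1; rewrite card_cross_edge_faces // card_one_sided_faces //.
rewrite card_apical_edges dim_boundary_complete_graph ?card_vertices //.
have e2 : faces K 2 = faces L 2.
  apply/setP => s; rewrite !inE; have [/eqP cs|] := boolP (#|s| == 3).
    by rewrite K3 // -card_gt0 cs !andbT.
  by rewrite !andbF.
have <- := dim_boundaries_one_sided F (isT : 0 < 1).
by rewrite /betti /boundaries (eq_chains F e2); lia.
Qed.

(* The cross edges form a grid, in which each cross triangle joins two adjacent
   nodes; these triangles form a spanning tree of the grid. *)
Definition tree_index := [set q : bool * ('I_n * 'I_n.+1) | ~~ q.1 || (q.2.2 == 0 :> nat)].
Definition tree_triangles := [set cross_triangle q | q in tree_index].

(** There are [n(n+1)] tree triangles with two vertices on side [false] and [n] with two on side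
    [true]. *)
Lemma card_tree_triangles : #|tree_triangles| = n.+1 ^ 2 - 1.
Proof.
rewrite card_imset; last exact: cross_triangle_inj.
rewrite -(cardsID [set q | q.1]).
have -> : tree_index :&: [set q | q.1] = setX [set true] (setX setT [set ord0]).
  by apply/setP => -[[] [i j]]; rewrite !inE -?val_eqE /= ?andbT ?andbF.
have -> : tree_index :\: [set q | q.1] = setX [set false] setT.
  by apply/setP => -[[] [i j]]; rewrite !inE -?val_eqE /= ?andbT ?andbF.
by rewrite !cardsX !cards1 !cardsT card_prod !card_ord; lia.
Qed.

(** One matching combines apical triangles, paired with one-sided edges, and tree triangles, paired
    with cross edges. *)
Lemma geq_dim_boundaries_cross (F : fieldType) K :
  faces L 2 \subset faces K 2 -> cross_triangles \subset faces K 2 ->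
  #|apical_faces 2| + (n.+1 ^ 2 - 1) <= \dim (boundary F T @: chains F K 2).
Proof.
move=> /subsetP LK /subsetP XK.
have two_sided q : q \in tree_triangles -> ~~ one_sided q.
  by case/imsetP => {}q _ ->; apply: cross_triangle_two_sided.
have one_sidedA q : q \in apical_faces 2 -> one_sided q.
  by rewrite !inE => /andP[/andP[/andP[_ ->]]].
(* The matching removes the lower of the two consecutive vertices; replacing it
   by another vertex that gives a tree triangle always increases the weight. *)
pose wt x := idx x + ~~ side x * n.+1.
(* One-sided faces get weight 0, strictly below every tree triangle. *)
pose r s := if one_sided s then 0 else (\sum_(x in s) wt x).+1.
rewrite -card_tree_triangles.
have <- : #|apical_faces 2 :|: tree_triangles| = #|apical_faces 2| + #|tree_triangles|.
  apply/eqP; rewrite (leq_card_setU _ _).2 disjoint_subset; apply/subsetP => s.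
  by move=> /one_sidedA os; rewrite !inE; apply/negP => /two_sided; rewrite os.
apply: (@geq_dim_boundaries _ _ _ _ _ r) => [|s].
  apply/subsetP => s /setUP[|/imsetP[q _ ->]]; last exact/XK/imset_f.
  by rewrite inE => /andP[/LK].
case/setUP => [sA|].
  have [v vs nA] := apical_facet (isT : 0 < 2) sA; exists v => // u us uv.
  rewrite inE (negPf (nA _ us uv)) /= => /two_sided osu.
  by rewrite /r one_sidedA // (negPf osu).
case/imsetP => -[b [i j]] /[1!inE] /= tb ->; set s0 := cross_triangle _.
set v := e (b, widen_ord (leqnSn n) i); pose w := e (b, lift ord0 i); pose z := e (~~ b, j).
have vs : v \in s0 by rewrite !inE eqxx.
exists v => // u us uv uS.
have s0v : s0 :\ v = [set w; z].
  apply/setP => x; rewrite !inE -/w -/v -/z.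
  case: (x =P v) => [->|] //=; rewrite !eq_e /= /bump; case: b {s0 v w z tb vs us uv uS} => /=; lia.
have nos : ~~ one_sided (u |: (s0 :\ v)).
  apply/negP => /one_sidedP/(_ w z); rewrite s0v !inE !eqxx !orbT !side_e.
  by move=> /(_ isT isT); case: (b).
have := uS; rewrite inE => /orP[/one_sidedA|/imsetP[[c [k l]]]]; first by rewrite (negPf nos).
rewrite inE /= => tc eqt.
rewrite /r (negPf nos) (negPf (cross_triangle_two_sided _)) ltnS.
(* It remains that [wt v < wt u]. If [b] is [false], [w] has nonzero index, so [u] can only be
   [(false, i + 2)]. If [b] is [true], [z] has index 0 and [u] is [(true, i + 2)] or [(false, 1)],
   the latter heavier by the offset [n + 1]. *)
rewrite (big_setU1 _ us) (big_setD1 v vs) /= ltn_add2r.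
move: eqt us uv; rewrite s0v -(gK u); case: (g u) => d m /setP h.
have := h w; have := h z; have := h (e (d, m)).
rewrite !cross_triangleE !inE !eqxx !orbT /= !eq_e /wt !side_e !idx_e /= /bump !leq0n.
move: tb tc (ltn_ord i) (ltn_ord m).
by case: b c d {h s0 v w z vs uS s0v nos} => [] [] []; rewrite /= ?andbF; lia.
Qed.

(** The edge count and [d_1 = 2n + 1] bound [d_2] above by [a_2 + (n+1)^2 - 1], which the matching
    attains. Of the [a_2 + a_3 + 2n(n+1)] triangles this leaves [a_3 + n^2] for the cycles, and
    [d_3 = a_3]. *)
Theorem betti2_cross (F : fieldType) K : simplicial_complex K ->
  (forall s, #|s| = 1 -> s \in K) -> (forall s, #|s| = 2 -> s \in K) ->
  (forall s, #|s| = 3 -> (s \in K) = one_sided s || (s \in cross_triangles)) ->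
  (forall s, #|s| = 4 -> (s \in K) = one_sided s) ->
  betti F K 2 = n ^ 2.
Proof.
move=> sK K1 K2 K3 K4.
have cX : #|cross_triangles| = (n * n.+1).*2.
  by rewrite card_imset ?cardsT ?card_prod ?card_bool ?card_ord ?mul2n //; apply: cross_triangle_inj.
have subL : faces L 2 \subset faces K 2.
  apply/subsetP => s; rewrite !inE => /andP[/andP[_ os] /eqP cs].
  by rewrite K3 // os cs.
have subX : cross_triangles \subset faces K 2.
  apply/subsetP => s sX; case/imsetP: (sX) => q _ sq.
  by rewrite inE K3 ?sX ?orbT sq card_cross_triangle.
have c2 : #|faces K 2| = #|faces L 2| + (n * n.+1).*2.
  rewrite -cX -(cardsID [set s : {set T} | one_sided s] (faces K 2)); congr (_ + _).
    apply: eq_card => s; rewrite !inE; have [/eqP cs|] := boolP (#|s| == 3).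
      by rewrite K3 // -card_gt0 cs andbT /=; case: one_sided; rewrite ?andbF.
    by rewrite !andbF.
  apply: eq_card => s; rewrite !inE; apply/idP/idP => [|sX].
    by case/andP => os /andP[+ /eqP cs]; rewrite K3 // (negPf os).
  have := subsetP subX _ sX; rewrite inE => ->; case/imsetP: sX => q _ ->.
  by rewrite cross_triangle_two_sided.
have e3 : faces K 3 = faces L 3.
  apply/setP => s; rewrite !inE; have [/eqP cs|] := boolP (#|s| == 4).
    by rewrite K4 // -card_gt0 cs !andbT.
  by rewrite !andbF.
have := dim_cycles F K 2; rewrite c2 card_one_sided_faces //.
have := leq_dim_boundaries F 1 sK.
rewrite card_cross_edge_faces // card_one_sided_faces //.
rewrite card_apical_edges dim_boundary_complete_graph ?card_vertices //.
have := geq_dim_boundaries_cross F subL subX.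
have := dim_boundaries_one_sided F (isT : 0 < 2).
rewrite /betti /boundaries (eq_chains F e3) -!mulnn !mulnS !mulSn.
set d2 := \dim (_ @: chains F K 2); set d3 := \dim (_ @: _).
move: d2 d3 (\dim _) #|apical_faces 2| #|apical_faces 3| => d2 d3 z a2 a3; lia.
Qed.

End TwoSides.

(** * Points on two parabolas *)

Section SquaredDistance.
Variables (R : realType).

Definition sqdist d (x y : 'rV[R]_d) : R := \sum_i (x 0 i - y 0 i) ^+ 2.

Lemma edist_le_sqrt d (x y : 'rV[R]_d) c : 0 <= c ->
  (edist x y <= Num.sqrt c) = (sqdist x y <= c).
Proof. by move=> c0; rewrite ler_sqrt. Qed.

(* The two sides differ by the squared distance from x to the barycentre. *)
Lemma sqdist_triangle d (x p q r : 'rV[R]_d) :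
  sqdist p q / 16%:R + sqdist p r / 8%:R + sqdist q r / 8%:R <=
  sqdist x p / 4%:R + sqdist x q / 4%:R + sqdist x r / 2%:R.
Proof.
rewrite /sqdist !mulr_suml -!big_split; apply: ler_sum => i _ /=.
rewrite -subr_ge0; set y := (X in 0 <= X).
have -> : y = (x 0 i - (p 0 i + q 0 i) / 4%:R - r 0 i / 2%:R) ^+ 2.
  by rewrite /y; field.
exact: sqr_ge0.
Qed.

(** The same identity at the barycentre with equal weights. With two vertices per side, the four
    cross distances contribute 1/4 and the two gaps [h^2/8]. *)
Lemma sqdist_tetrahedron d (x p q r s : 'rV[R]_d) :
  (sqdist p q + sqdist p r + sqdist p s + sqdist q r + sqdist q s + sqdist r s)
    / 16%:R <=
  (sqdist x p + sqdist x q + sqdist x r + sqdist x s) / 4%:R.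
Proof.
rewrite /sqdist -!big_split !mulr_suml; apply: ler_sum => i _ /=.
rewrite -subr_ge0; set y := (X in 0 <= X).
have -> : y = (x 0 i - (p 0 i + q 0 i + r 0 i + s 0 i) / 4%:R) ^+ 2.
  by rewrite /y; field.
exact: sqr_ge0.
Qed.

(* The isometry (x, y, z) |-> (1 - x, z, y) exchanges the two parabolas. *)
Definition vec3 (b : bool) (x y z : R) : 'rV[R]_3 :=
  \row_i (if b then [:: 1 - x; z; y] else [:: x; y; z])`_i.

Lemma sqdist_vec3 b x y z x' y' z' :
  sqdist (vec3 b x y z) (vec3 b x' y' z') =
  (x - x') ^+ 2 + (y - y') ^+ 2 + (z - z') ^+ 2.
Proof.
rewrite /sqdist !big_ord_recl big_ord0 !mxE /= /bump /=.
by case: b => /=; ring.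
Qed.

Lemma vec3N b x y z : vec3 (~~ b) x y z = vec3 b (1 - x) z y.
Proof.
apply/rowP => i; rewrite !mxE; case: b => //=.
by rewrite opprB addrC subrK.
Qed.

Definition parabola (b : bool) (t : R) := vec3 b (1 - t ^+ 2 / 2%:R) t 0.

Lemma sqdist_parabola b t u :
  sqdist (parabola b t) (parabola b u) =
  (t - u) ^+ 2 + (t ^+ 2 - u ^+ 2) ^+ 2 / 4%:R.
Proof. by rewrite sqdist_vec3; field. Qed.

(** The curvature of the arcs makes the quadratic terms cancel: [(1 - t^2/2 - u^2/2)^2 + t^2 + u^2]
    has only a quartic error. *)
Lemma sqdist_parabolaN b t u :
  sqdist (parabola b t) (parabola (~~ b) u) =
  1 + (t ^+ 2 + u ^+ 2) ^+ 2 / 4%:R.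
Proof. by rewrite /parabola vec3N sqdist_vec3; field. Qed.

End SquaredDistance.

(** * The point cloud *)

Section TwoParabolas.
Variables (R : realType) (n : nat).
Hypothesis (n_gt1 : (1 < n)%N).
Local Notation index := (bool * 'I_n.+1)%type.

(** Chosen so that [(n h)^2 = h/16]; the error [(t^2 + u^2)^2 / 4] is then at most [h^2/256]. *)
Definition step : R := (16%:R * n%:R ^+ 2)^-1.
Local Notation h := step.
Definition param (k : nat) : R := h * k%:R.
Definition point (q : index) : 'rV[R]_3 := parabola q.1 (param q.2).

Lemma step_gt0 : 0 < h.
Proof. by rewrite invr_gt0 -natrX -natrM ltr0n; nia. Qed.

Lemma step_le : h <= 64%:R^-1.
Proof.
rewrite /step -natrX -natrM.
by rewrite lef_pV2 ?posrE ?ltr0n ?ler_nat; nia.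
Qed.

Lemma param_ge0 k : 0 <= param k.
Proof. by rewrite mulr_ge0 ?ler0n // ltW ?step_gt0. Qed.

Lemma sqr_param_le (i : 'I_n.+1) : param i ^+ 2 <= h / 16%:R.
Proof.
have n0 : (n%:R : R) != 0 by rewrite pnatr_eq0; lia.
have -> : h / 16%:R = (h * n%:R) ^+ 2 by rewrite /step; field.
rewrite lerXn2r ?nnegrE ?param_ge0 ?(param_ge0 n) //.
by rewrite ler_pM2l ?step_gt0 // ler_nat -ltnS.
Qed.

Lemma sqdist_point_cross_ge1 b i j :
  1 <= sqdist (point (b, i)) (point (~~ b, j)).
Proof. by rewrite sqdist_parabolaN lerDl divr_ge0 ?sqr_ge0. Qed.

Lemma sqdist_point_gap b (i j : 'I_n.+1) (m : nat) : (i + m <= j)%N ->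
  (m%:R * h) ^+ 2 <= sqdist (point (b, i)) (point (b, j)).
Proof.
move=> ij; rewrite sqdist_parabola /= -[(param i - _) ^+ 2]sqrrN opprB.
apply: (@le_trans _ _ ((param j - param i) ^+ 2)); last first.
  by rewrite lerDl divr_ge0 ?sqr_ge0.
have gap : m%:R * h <= param j - param i.
  by rewrite /param -mulrBr mulrC ler_pM2l ?step_gt0 // -natrB ?ler_nat; lia.
have mh0 : 0 <= m%:R * h by rewrite mulr_ge0 ?ler0n ?ltW ?step_gt0.
by rewrite lerXn2r ?nnegrE // (le_trans mh0).
Qed.

Lemma sqdist_refl d (x : 'rV[R]_d) : sqdist x x = 0.
Proof. by rewrite /sqdist big1 // => i _; rewrite subrr expr0n. Qed.

Lemma point_inj : injective point.
Proof.
move=> [b i] [c j] pq; have [bc|nbc] := eqVneq b c; last first.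
  have := sqdist_point_cross_ge1 b i j; have -> : ~~ b = c by case: b c nbc {pq} => [] [].
  by rewrite pq sqdist_refl ler10.
subst c; congr (_, _); apply: val_inj => /=.
have gap1 (k l : 'I_n.+1) : point (b, k) = point (b, l) -> (k < l)%N = false.
  move=> kl; apply/negP; rewrite -addn1 => /(sqdist_point_gap b).
  by rewrite kl sqdist_refl mul1r leNgt exprn_gt0 ?step_gt0.
by have := gap1 _ _ pq; have := gap1 _ _ (esym pq); lia.
Qed.

(** Passing to squared radii keeps all later estimates polynomial. *)
Lemma CechP d (B : {fset 'rV[R]_d}) c (s : {set B}) : 0 <= c ->
  reflect (s != set0 /\ exists x, forall a, a \in s -> sqdist x (val a) <= c)
          (s \in Cech B (Num.sqrt c)).
Proof.
move=> c0; rewrite inE; apply: (iffP andP) => -[s0].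
  move=> /asboolP[x sx]; split=> //; exists x => a /sx.
  by rewrite /closed_eball /= edist_le_sqrt.
case=> x sx; split=> //; apply/asboolP; exists x => a /= /sx.
by rewrite /closed_eball /= edist_le_sqrt.
Qed.

Definition cloud : {fset 'rV[R]_3} := [fset point q | q in [set: index]]%fset.

Lemma point_in_cloud q : point q \in cloud.
Proof. by apply/imfsetP; exists q; rewrite /= ?inE. Qed.

Definition vertex q : cloud := [` point_in_cloud q]%fset.

Lemma card_cloud : #|` cloud| = n.+1.*2.
Proof.
rewrite card_imfset; last exact: point_inj.
rewrite /= -cardE cardsT card_prod card_bool card_ord. lia.
Qed.

Lemma vertex_bij : bijective vertex.
Proof.
apply: inj_card_bij => [p q /(congr1 val) /point_inj //|].
by rewrite -cardfE card_cloud card_prod card_bool card_ord; lia.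
Qed.


(** * Faces of the Čech complexes of the cloud *)

Variable g : cloud -> index.
Hypotheses (vertexK : cancel vertex g) (gK : cancel g vertex).
Implicit Types (c : R) (s : {set cloud}).

Lemma Cech_one_sided c s : 4%:R^-1 <= c -> s != set0 -> one_sided g s ->
  s \in Cech cloud (Num.sqrt c).
Proof.
move=> c4 s0 /one_sidedP os; have c0 : 0 <= c by apply: le_trans c4; rewrite invr_ge0 ler0n.
apply/CechP => //; split=> //; have /set0Pn[x xs] := s0.
(* The centre is the point of parameter 0 on the common arc. *)
exists (vec3 (side g x) 1 0 0) => a sa; rewrite -(gK a) /=.
rewrite /point -[(g a).1]/(side g a) (os _ _ sa xs) sqdist_vec3.
have := sqr_param_le (g a).2; have := step_le; have := sqr_ge0 (param (g a).2).
by set t := param _; move: h c4 => h' c4; nra.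
Qed.

Lemma Cech_cross_edge c q : 4%:R^-1 + h ^+ 2 / 32%:R <= c ->
  cross_edge vertex q \in Cech cloud (Num.sqrt c).
Proof.
case: q => i j hc; have := step_gt0 => h0.
have c0 : 0 <= c by have := sqr_ge0 h; lra.
apply/CechP => //; split; first by apply/set0Pn; exists (vertex (false, i)); rewrite !inE eqxx.
pose t := param i; pose u := param j.
have t2 : t ^+ 2 <= h / 16%:R := sqr_param_le i.
have u2 : u ^+ 2 <= h / 16%:R := sqr_param_le j.
have t0 := sqr_ge0 t; have u0 := sqr_ge0 u.
have tu : (t ^+ 2 + u ^+ 2) ^+ 2 <= (h / 8%:R) ^+ 2 by rewrite lerXn2r ?nnegrE; lra.
(* The midpoint of the two vertices. *)
exists (vec3 false (2%:R^-1 - t ^+ 2 / 4%:R + u ^+ 2 / 4%:R) (t / 2%:R) (u / 2%:R)) => a.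
rewrite !inE => /pred2P[]-> /=; rewrite /point /parabola /= -/t -/u.
  by rewrite sqdist_vec3; nra.
by rewrite -[true]/(~~ false) vec3N sqdist_vec3; nra.
Qed.

Lemma Cech_cross_triangle c q : 4%:R^-1 + h ^+ 2 / 32%:R * 3%:R <= c ->
  cross_triangle vertex q \in Cech cloud (Num.sqrt c).
Proof.
case: q => b [i j] hc; have h0 := step_gt0; have h1 := step_le.
have c0 : 0 <= c by have := sqr_ge0 h; lra.
apply/CechP => //; split.
  by apply/set0Pn; exists (vertex (~~ b, j)); rewrite !inE eqxx orbT.
pose t := param i; pose t' := param i.+1; pose u := param j.
have t2 : t ^+ 2 <= h / 16%:R := sqr_param_le (widen_ord (leqnSn n) i).
have t'2 : t' ^+ 2 <= h / 16%:R := sqr_param_le (lift ord0 i).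
have u2 : u ^+ 2 <= h / 16%:R := sqr_param_le j.
have tt' : (t' - t) = h by rewrite /t /t' /param -mulrBr -natrB // subSnn mulr1.
have t0 := sqr_ge0 t; have u0 := sqr_ge0 u; have t'0 := sqr_ge0 t'.
have hh : h ^+ 2 <= h / 64%:R by rewrite expr2 ler_wpM2l // ltW.
have hh0 := sqr_ge0 h.
(* This centre is equidistant from the three vertices up to terms of order h^4:
   each squared distance is 1/4 + h^2/16 plus the square given to near below. *)
exists (vec3 b (2%:R^-1 + h ^+ 2 / 8%:R - (t ^+ 2 + t' ^+ 2) / 8%:R + u ^+ 2 / 4%:R)
  ((t + t') / 4%:R) (u / 2%:R)) => a.
have sq_small (y : R) : - (h / 16%:R) <= y -> y <= h / 16%:R -> y ^+ 2 <= h ^+ 2 / 256%:R.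
  by move=> y1 y2; nra.
have near (x y1 y2 : R) : x = 4%:R^-1 + h ^+ 2 / 16%:R + y1 ^+ 2 -> y1 = y2 ->
    - (h / 16%:R) <= y2 -> y2 <= h / 16%:R -> x <= c.
  by move=> -> -> lo hi; have := sq_small _ lo hi; lra.
have t'E : t' = t + h by rewrite -tt' addrC subrK.
rewrite !inE -orbA => /or3P[]/eqP-> /=; rewrite /point /parabola /= -/t -/t' -/u.
- rewrite sqdist_vec3.
  apply: (near _ (- t ^+ 2 / 2%:R - h ^+ 2 / 8%:R + (t ^+ 2 + t' ^+ 2) / 8%:R - u ^+ 2 / 4%:R)) => //; try lra.
  by rewrite t'E; field.
- rewrite sqdist_vec3.
  apply: (near _ (- t' ^+ 2 / 2%:R - h ^+ 2 / 8%:R + (t ^+ 2 + t' ^+ 2) / 8%:R - u ^+ 2 / 4%:R)) => //; try lra.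
  by rewrite t'E; field.
rewrite vec3N sqdist_vec3.
apply: (near _ (h ^+ 2 / 8%:R - (t ^+ 2 + t' ^+ 2) / 8%:R - u ^+ 2 / 4%:R)) => //; try lra.
by rewrite t'E; field.
Qed.

(** Weights 1/4, 1/4, 1/2 in [sqdist_triangle]: a common point of the balls would give
    [c >= 1/4 + (m h)^2/16]. *)
Lemma notin_Cech_triangle c s b (i j k : 'I_n.+1) m :
  0 <= c -> (i + m <= j)%N -> c < 4%:R^-1 + (m%:R * h) ^+ 2 / 16%:R ->
  vertex (b, i) \in s -> vertex (b, j) \in s -> vertex (~~ b, k) \in s ->
  s \notin Cech cloud (Num.sqrt c).
Proof.
move=> c0 /(sqdist_point_gap b) ij hc si sj sk; apply/negP => /CechP[] // _ [x sx].
have := sqdist_triangle x (point (b, i)) (point (b, j)) (point (~~ b, k)).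
have := sqdist_point_cross_ge1 b i k; have := sqdist_point_cross_ge1 b j k.
by move: (sx _ si) (sx _ sj) (sx _ sk) => /=; lra.
Qed.

Lemma notin_Cech_tetrahedron c s (i j k l : 'I_n.+1) :
  0 <= c -> (i < j)%N -> (k < l)%N -> c < 4%:R^-1 + h ^+ 2 / 8%:R ->
  vertex (false, i) \in s -> vertex (false, j) \in s ->
  vertex (true, k) \in s -> vertex (true, l) \in s ->
  s \notin Cech cloud (Num.sqrt c).
Proof.
rewrite -[i.+1]addn1 -[k.+1]addn1.
move=> c0 /(sqdist_point_gap false) ij /(sqdist_point_gap true) kl hc si sj sk sl.
apply/negP => /CechP[] // _ [x sx].
have := sqdist_tetrahedron x (point (false, i)) (point (false, j)) (point (true, k)) (point (true, l)).
have := sqdist_point_cross_ge1 false i k; have := sqdist_point_cross_ge1 false j k.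
have := sqdist_point_cross_ge1 false i l; have := sqdist_point_cross_ge1 false j l.
move: ij kl; rewrite !mul1r.
by move: (sx _ si) (sx _ sj) (sx _ sk) (sx _ sl) => /=; lra.
Qed.

Lemma Cech_low_faces c : 4%:R^-1 + h ^+ 2 / 32%:R <= c ->
  (forall s, #|s| = 1%N -> s \in Cech cloud (Num.sqrt c)) /\
  (forall s, #|s| = 2%N -> s \in Cech cloud (Num.sqrt c)).
Proof.
move=> hc; have c4 : 4%:R^-1 <= c by have := sqr_ge0 h; lra.
split=> s cs.
  apply: Cech_one_sided => //; first by rewrite -card_gt0 cs.
  by move/eqP/cards1P: cs => [x ->]; apply: one_sided1.
have [os|/(not_one_sidedP vertexK gK)[i [j [si sj]]]] := boolP (one_sided g s).
  by apply: Cech_one_sided => //; rewrite -card_gt0 cs.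
suff -> : s = cross_edge vertex (i, j) by apply: Cech_cross_edge.
apply/eqP; rewrite eq_sym eqEcard cs cards2 (eq_e vertexK) /= andbT.
by apply/subsetP => x; rewrite !inE => /pred2P[]->.
Qed.

(** This squared radius is below [1/4 + h^2/16], where the first cross triangles could appear. *)
Lemma betti1_Cech (F : fieldType) :
  betti F (Cech cloud (Num.sqrt (4%:R^-1 + h ^+ 2 / 32%:R))) 1 = ((n + 1) ^ 2 - 1)%N.
Proof.
set c := _ + _; have [|K1 K2] := @Cech_low_faces c; first by [].
have h2 : 0 < h ^+ 2 by rewrite exprn_gt0 ?step_gt0.
have c0 : 0 <= c by rewrite /c; lra.
apply: (betti1_one_sided vertexK gK) => //; first exact: Cech_simplicial_complex.
move=> s cs; have [os|ts] := boolP (one_sided g s).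
  by apply: Cech_one_sided; rewrite ?os // -?card_gt0 ?cs // /c; lra.
have [b [i [j [k [ij sE]]]]] := two_sided_card3 vertexK gK cs ts.
apply/negbTE/(@notin_Cech_triangle _ _ b i j k 1) => //; rewrite ?sE ?inE ?eqxx ?orbT ?addn1 //.
by rewrite mul1r /c; lra.
Qed.

(** The coefficient 3/32 lies between 1/16 for triangles on consecutive points and 1/8 for
    tetrahedra split 2+2; a gap of two steps needs 1/4. *)
Lemma betti2_Cech (F : fieldType) :
  betti F (Cech cloud (Num.sqrt (4%:R^-1 + h ^+ 2 / 32%:R * 3%:R))) 2 = (n ^ 2)%N.
Proof.
have h2 : 0 < h ^+ 2 by rewrite exprn_gt0 ?step_gt0.
set c := _ + _; have [|K1 K2] := @Cech_low_faces c; first by rewrite /c; lra.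
have c0 : 0 <= c by rewrite /c; lra.
have c4 : 4%:R^-1 <= c by rewrite /c; lra.
apply: (betti2_cross vertexK gK) => //; first exact: Cech_simplicial_complex.
  move=> s cs; have [os|ts] /= := boolP (one_sided g s).
    by apply: Cech_one_sided; rewrite // -?card_gt0 ?cs.
  apply/idP/imsetP => [|[q _ ->]]; last exact: Cech_cross_triangle.
  have [b [i [j [k [ij sE]]]]] := two_sided_card3 vertexK gK cs ts.
  (* A gap of two steps is excluded, so [j = i + 1] and [s] is a cross triangle. *)
  have [ij2|ji] := leqP (i + 2) j.
    rewrite (negbTE (@notin_Cech_triangle c s b i j k 2 _ _ _ _ _ _)) //;
      rewrite ?sE ?inE ?eqxx ?orbT //.
    by rewrite exprMn /c; lra.
  have jn : (i < n)%N by have := ltn_ord j; lia.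
  move=> _; exists (b, (Ordinal jn, k)) => //; rewrite sE /cross_triangle /=.
  congr [set vertex (b, _); vertex (b, _); _]; apply: val_inj => //=.
  by rewrite /bump; lia.
move=> s cs; have [os|ts] := boolP (one_sided g s).
  by apply: Cech_one_sided; rewrite // -?card_gt0 ?cs.
apply/negbTE; have [[b [i [j [k [ij [si sj sk]]]]]]|] := two_sided_card4 vertexK gK cs ts.
  apply: (@notin_Cech_triangle _ _ b i j k 2) => //.
  by rewrite exprMn /c; lra.
case=> i [j [k [l [ij kl [si sj sk sl]]]]].
by apply: (@notin_Cech_tetrahedron _ _ i j k l) => //; rewrite /c; lra.
Qed.

End TwoParabolas.

Theorem mainTheorem3 (F : fieldType) (R : realType) (n : nat) (hn : (2 <= n)%N) :
  exists (A : {fset 'rV[R]_3}) (rho1 rho2 : R),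
    [/\ #|` A| = (2 * n + 2)%N,
        [/\ 0 <= rho1, 0 <= rho2 & rho1 != rho2],
        betti F (Cech A rho1) 1 = ((n + 1) ^ 2 - 1)%N &
        betti F (Cech A rho2) 2 = (n ^ 2)%N].
Proof.
have [g vK gK] := vertex_bij R hn.
have h2 : 0 < step R n ^+ 2 by rewrite exprn_gt0 ?step_gt0.
exists (cloud R n), (Num.sqrt (4%:R^-1 + step R n ^+ 2 / 32%:R)),
  (Num.sqrt (4%:R^-1 + step R n ^+ 2 / 32%:R * 3%:R)); split.
- by rewrite card_cloud //; lia.
- split; rewrite ?sqrtr_ge0 // eqr_sqrt; lra.
- exact: betti1_Cech vK gK F.
exact: betti2_Cech vK gK F.
Qed.
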